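(* Let $G$ be a semi-balanced digraph, let $\mathcal{T}$ be any dissecting tree set for $G$, and fix any total ordering of the edges of $G$. Then for every $i$, the coefficient of $x^i$ in the $h^*$-polynomial of the root polytope $\mathcal{Q}_G$ equals $$|\{T\in \mathcal{T}\mid T \text{ has exactly } i \text{ internally semi-passive edges}\}|.$$
   Context: A digraph $G$ is semi-balanced if every cycle (of the underlying undirected graph) has the same number of edges oriented in each of the two cyclic directions. For a vertex $u$, $\mathbf{1}_u$ is the standard basis vector of $\mathbb{R}^{V(G)}$. For a digraph $D$, the root polytope is $\mathcal{Q}_D=\mathrm{conv}\{\mathbf{1}_h-\mathbf{1}_t \mid \overrightarrow{th}\in E(D)\}$. A dissecting tree set for $G$ is a set $\mathcal{T}$ of spanning trees of $G$ such that the simplices $\mathcal{Q}_T$, $T\in\mathcal{T}$, have pairwise disjoint relative interiors and their union is $\mathcal{Q}_G$. For a spanning tree $T$ and $e\in T$, the fundamental cut $C^*(T,e)$ is the set of edges of $G$ joining the two components (shores) of $T-e$; an edge $e'\in C^*(T,e)$ stands parallel to $e$ if the heads of $e$ and $e'$ lie in the same shore, and opposite otherwise. Given a total order on $E(G)$, an edge $e\in T$ is internally semi-passive for $T$ if the maximal edge of $C^*(T,e)$ stands opposite to $e$. For a $d$-dimensional lattice polytope $P\subset\mathbb{R}^n$ with Ehrhart polynomial $\varepsilon_P(t)=|tP\cap\mathbb{Z}^n|$, writing uniquely $\varepsilon_P(t)=\sum_{k=0}^d a_k\binom{t+d-k}{d}$, the $h^*$-polynomial of $P$ is $\sum_{k=0}^d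 a_k x^k$. *)

(* Defs.v *)
From mathcomp Require Export all_boot all_order all_algebra finmap.
From mathcomp Require Export boolp classical_sets cardinality reals.
Set Implicit Arguments.
Unset Strict Implicit.
Unset Printing Implicit Defensive.

Import Order.TTheory GRing.Theory Num.Theory.
Local Open Scope classical_set_scope.
Local Open Scope ring_scope.

(* Finite directed multigraphs: edges are abstract, so parallel edges are
   allowed; an edge [e] points from [tail e] to [head e]. *)
Record digraph := Digraph {
  vertex : finType;
  edge : finType;
  tail : edge -> vertex;
  head : edge -> vertex }.

Section Graphs.
Variable G : digraph.
Implicit Types (e f : edge G) (D T : {set edge G}) (u v : vertex G).

(* A dart [(e, true)] is [e] traversed from tail to head, [(e, false)] is [e]
   traversed from head to tail. *)
Definition dart := (edge G * bool)%type.
Definition dart_source (d : dart) : vertex G :=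
  if d.2 then tail d.1 else head d.1.
Definition dart_target (d : dart) : vertex G :=
  if d.2 then head d.1 else tail d.1.

(* A cycle of the underlying undirected graph, with a direction of traversal.
   Distinctness of the edges only matters in length 2, where it excludes going
   back and forth along one edge; a loop is a cycle of length 1. *)
Definition graph_cycle (c : seq dart) : bool :=
  [&& c != [::],
      path.cycle (fun d d' => dart_target d == dart_source d') c,
      uniq (map dart_source c) & uniq (unzip1 c)].

Definition semi_balanced : Prop :=
  forall c, graph_cycle c -> count (fun d => d.2) c = count (fun d => ~~ d.2) c.

Definition adjacent D : rel (vertex G) := fun u v =>
  [exists e in D, ((tail e == u) && (head e == v))
               || ((tail e == v) && (head e == u))].

(* A spanning tree, given by its edge set. *)
Definition spanning_tree T : Prop :=
  (forall u v, connect (adjacent T) u v) /\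
  (forall c, graph_cycle c -> ~~ all (fun d => d.1 \in T) c).

Definition head_shore T e : pred (vertex G) :=
  connect (adjacent (T :\ e)%SET) (head e).

Definition fundamental_cut T e : {set edge G} :=
  [set f | head_shore T e (tail f) != head_shore T e (head f)]%SET.

Definition stands_opposite T e f : bool := ~~ head_shore T e (head f).

Definition internally_semi_passive (le : rel (edge G)) T e : bool :=
  (e \in T) &&
  [exists f in fundamental_cut T e,
     [forall g in fundamental_cut T e, le g f] && stands_opposite T e f].

End Graphs.

Section Polytopes.
Variables (R : realType) (V : finType).
(* R^V *)
Local Notation RV := {ffun V -> R^o}.
Implicit Types (S P : set RV).

Definition convex_hull S : set RV :=
  [set x | exists n (a : 'I_n -> R) (p : 'I_n -> RV),
     [/\ forall i, 0 <= a i, \sum_i a i = 1, forall i, S (p i)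
       & x = \sum_i a i *: p i]].

Definition affine_hull S : set RV :=
  [set x | exists n (a : 'I_n -> R) (p : 'I_n -> RV),
     [/\ \sum_i a i = 1, forall i, S (p i) & x = \sum_i a i *: p i]].

Definition relative_interior S : set RV :=
  [set x | S x /\ exists2 eps : R, 0 < eps &
     forall y, affine_hull S y -> (forall v, `|y v - x v| < eps) -> S y].

(* The affine hull of [S] is a translate of a [d]-dimensional linear subspace;
   in particular [S] is nonempty. *)
Definition has_dimension S (d : nat) : Prop :=
  exists (x : RV) (U : {vspace RV}),
    \dim U = d /\ affine_hull S = [set x + u | u in [set u | u \in U]].

Definition dilated_lattice_points P (t : nat) : set RV :=
  [set x | (exists2 p, P p & x = t%:R *: p) /\ forall v, x v \is a Num.int].

(* [fset_set] is the empty set on infinite sets; polytopes being bounded, their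
   dilations contain finitely many lattice points. *)
Definition ehrhart P (t : nat) : nat := #|` fset_set (dilated_lattice_points P t)|.

Definition is_hstar P (h : {poly rat}) : Prop :=
  exists d, [/\ has_dimension P d, (size h <= d.+1)%N &
    forall t : nat,
      (ehrhart P t)%:R = \sum_(k < d.+1) h`_k * ('C(t + d - k, d))%:R].

(* The default value 0 is only used when no such polynomial exists. *)
Definition hstar P : {poly rat} := xget 0 (is_hstar P).

End Polytopes.

Section RootPolytope.
Variables (R : realType) (G : digraph).

Definition std_basis (u : vertex G) : {ffun vertex G -> R^o} :=
  [ffun v => (v == u)%:R].

(* The root polytope of the spanning subgraph of [G] with edge set [D]. *)
Definition root_polytope (D : {set edge G}) : set {ffun vertex G -> R^o} :=
  convex_hull [set std_basis (head e) - std_basis (tail e) | e in [set` D]].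

Definition dissecting_tree_set (TT : {set {set edge G}}) : Prop :=
  [/\ forall T, T \in TT -> spanning_tree T,
      forall T T', T \in TT -> T' \in TT -> T != T' ->
        relative_interior (root_polytope T) `&`
        relative_interior (root_polytope T') = set0 &
      \bigcup_(T in [set` TT]) root_polytope T = root_polytope [set: edge G]%SET].

End RootPolytope.

Arguments std_basis R {G} u.
Arguments root_polytope R {G} D.
Arguments dissecting_tree_set R {G} TT.

Definition total_order (E : Type) (le : rel E) : Prop :=
  [/\ reflexive le, antisymmetric le, transitive le & total le].

(* Main.v *)
Require Import Defs.
From mathcomp Require Import all_boot all_order all_algebra finmap.
From mathcomp Require Import boolp classical_sets cardinality reals.
From HB Require Import structures.
From mathcomp Require Import zify lra.
Import Defs.
Set Implicit Arguments.
Unset Strict Implicit.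
Unset Printing Implicit Defensive.
Import Order.TTheory GRing.Theory Num.Theory.
Local Open Scope ring_scope.

(* For a spanning tree T, the roots 1_h - 1_t of its edges form a lattice basis
   of the zero-sum vectors; the coordinate of x along e in T is the sum of x
   over the head shore of T - e.  Semi-balancedness puts all roots of G on one
   affine hyperplane missing the origin.  Weight the edges so that each weight
   exceeds the sum of all smaller ones and the total is less than 1, and let q
   be the weighted sum of all roots.  The e-coordinate of q is a signed sum of
   the weights of the fundamental cut, so its sign is that of the maximal edge:
   it is negative iff e is internally semi-passive, and it has modulus < 1.
   For a lattice point p of t Q_G, the point p + q lies in the interior of
   exactly one cone over a simplex of the dissection, and this means that the
   coordinates of p there are nonnegative integers of sum t, positive on the
   semi-passive edges.  Counting them gives
   the sum over T of C(t + d - k(T), d), with k(T) the number of semi-passive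
   edges. *)

(** * Combinatorial preliminaries: compositions, dominating weights, uniqueness of the
    h*-polynomial *)

Definition composition (E : finType) (T S : {set E}) (t : nat)
    (a : {ffun E -> 'I_t.+1}) : bool :=
  [&& [forall e in ~: T, a e == ord0], [forall e in S, (0 < a e)%N]
    & (\sum_(e in T) a e == t)%N].

(** Subtracting 1 at each element of [S] leaves weak compositions of [t - #|S|] into [d + 1] parts,
    a stars-and-bars count. For [t < #|S|] both sides vanish; there [#|S| <= d] keeps the truncated
    subtraction exact. *)
Lemma card_composition (E : finType) (T S : {set E}) (d t : nat) :
  S \subset T -> #|T| = d.+1 -> (#|S| <= d)%N ->
  #|[set a | composition T S (t := t) a]| = 'C(t + d - #|S|, d).
Proof.
move=> sST cT leSd.
have sumS : (\sum_(e in T) (e \in S) = #|S|)%N.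
  rewrite -sum1_card big_mkcond [RHS]big_mkcond; apply: eq_bigr => e _ /=.
  by case: (boolP (e \in S)) => [/(fintype.subsetP sST) ->|]; case: (e \in T).
have [ltS|leS] := ltnP t #|S|.
  rewrite bin_small; last by lia.
  apply/eqP; rewrite cards_eq0; apply/eqP/setP => a; rewrite !inE.
  apply/negP => /and3P[_ /forall_inP posS /eqP suma].
  have : (\sum_(e in T) (e \in S) <= \sum_(e in T) a e)%N.
    by apply: leq_sum => e _; case: (boolP (e \in S)) => // /posS.
  by rewrite sumS suma leqNgt ltS.
set n := (t - #|S|)%N.
have -> : (t + d - #|S| = d + n)%N by rewrite /n; lia.
rewrite -card_ord_partitions.
have [e0 e0T] : exists e, e \in T by apply/set0Pn; rewrite -card_gt0 cT.
pose s := enum T.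
have sz_s : size s = d.+1 by rewrite -cardE.
have sumT F : (\sum_(e in T) F e = \sum_(i < d.+1) F (nth e0 s i))%N.
  by rewrite -big_enum /= (big_nth e0) sz_s big_mkord.
have sT (i : 'I_d.+1) : nth e0 s i \in T by rewrite -mem_enum mem_nth ?sz_s.
have idx_s (i : 'I_d.+1) : index (nth e0 s i) s = i.
  by rewrite index_uniq ?enum_uniq ?sz_s.
(* [phi] numbers the elements of [T] by [enum T] and adds back the 1 on [S]. Entries stay at most
   [t], so [inord] is exact. *)
pose phi (b : d.+1.-tuple 'I_n.+1) : {ffun E -> 'I_t.+1} :=
  [ffun e => if e \in T then inord (nth ord0 b (index e s) + (e \in S)) else ord0].
have phiE b (i : 'I_d.+1) :
    phi b (nth e0 s i) = (tnth b i + (nth e0 s i \in S))%N :> nat.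
  rewrite ffunE sT idx_s (tnth_nth ord0) inordK // ltnS.
  move: (ltn_ord (nth ord0 b i)); set m := nth _ _ _; rewrite ltnS /n.
  case: (boolP (nth e0 s i \in S)) => /= [iS|_]; last by lia.
  have : (0 < #|S|)%N by rewrite card_gt0; apply/set0Pn; exists (nth e0 s i).
  by lia.
have phi_inj : injective phi.
  move=> b b' eq_b; apply: eq_from_tnth => i; apply: val_inj => /=.
  by apply/eqP; rewrite -(eqn_add2r (nth e0 s i \in S)) -!phiE eq_b.
rewrite -(card_imset _ phi_inj); apply: eq_card => a; rewrite inE.
apply/and3P/imsetP => [[/forall_inP a0 /forall_inP posS /eqP suma]|[b]].
  have subK (e : E) : (a e - (e \in S) + (e \in S) = a e)%N.
    case: (boolP (e \in S)) => [/posS|_]; last by rewrite subn0 addn0.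
    exact: subnK.
  have sumn : (\sum_(i < d.+1) (a (nth e0 s i) - (nth e0 s i \in S)) = n)%N.
    rewrite -(sumT (fun e => a e - (e \in S))%N); apply: (@addIn #|S|).
    rewrite -{1}sumS -big_split /= /n subnK // -[RHS]suma.
    by apply: eq_bigr => e _; apply: subK.
  have bn (i : 'I_d.+1) : (a (nth e0 s i) - (nth e0 s i \in S) < n.+1)%N.
    by rewrite ltnS -sumn (bigD1 i) //= leq_addr.
  exists [tuple Ordinal (bn i) | i < d.+1].
    rewrite inE big_tuple; apply/eqP; rewrite -[RHS]sumn.
    by apply: eq_bigr => i _; rewrite tnth_mktuple.
  apply/ffunP => e; apply: val_inj => /=.
  have [eT|eNT] := boolP (e \in T); last first.
    by rewrite ffunE (negPf eNT); apply/eqP/a0; rewrite inE.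
  have i_lt : (index e s < d.+1)%N by rewrite -sz_s index_mem mem_enum.
  have eE : e = nth e0 s (Ordinal i_lt) by rewrite nth_index ?mem_enum.
  by rewrite eE phiE tnth_mktuple /= subK.
rewrite inE big_tuple => /eqP sumb ->{a}; split.
- by apply/forall_inP => e; rewrite inE ffunE => /negPf ->.
- apply/forall_inP => e eS; have eT := fintype.subsetP sST _ eS.
  have i_lt : (index e s < d.+1)%N by rewrite -sz_s index_mem mem_enum.
  have eE : e = nth e0 s (Ordinal i_lt) by rewrite nth_index ?mem_enum.
  by rewrite eE phiE -eE eS addn1.
- rewrite sumT; under eq_bigr do rewrite phiE.
  by rewrite big_split /= sumb -(sumT (fun e => nat_of_bool (e \in S))) sumS /n subnK.
Qed.

(** The weights are powers of [M = #|E| + 1], the exponent being the position in the order: at most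
    [#|E|] powers with exponents below [r] add up to less than [M ^+ r]. A final division brings the
    total below 1. *)
Lemma dominating_weights (R : realFieldType) (E : finType) (le : rel E) :
  total_order le ->
  exists w : E -> R, [/\ forall f, 0 < w f, \sum_f w f < 1
    & forall f, \sum_(g | (g != f) && le g f) w g < w f].
Proof.
move=> [leR leA leT _].
pose M : R := #|E|.+1%:R.
pose rank f := #|[set h | le h f]|.
have M_gt0 : 0 < M by rewrite ltr0n.
have M_ge1 : 1 <= M by rewrite ler1n.
have rank_lt f g : g != f -> le g f -> (rank g < rank f)%N.
  move=> ngf lgf; apply/proper_card/properP; split.
    by apply/fintype.subsetP => h; rewrite !inE => /leT; apply.
  exists f; rewrite !inE ?leR //; apply/negP => lfg.
  by case/eqP: ngf; apply: leA; rewrite lgf lfg.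
have sum_lt (P : pred E) r : (forall g, P g -> (rank g < r)%N) ->
    \sum_(g | P g) M ^+ rank g < M ^+ r.
  move=> ltr; rewrite -(ltr_pM2l M_gt0) mulr_sumr.
  apply: (@le_lt_trans _ _ (\sum_(g : E) M ^+ r)).
    apply: (@le_trans _ _ (\sum_(g | P g) M ^+ r)).
      by apply: ler_sum => g /ltr lt; rewrite -exprS ler_weXn2l.
    rewrite [leRHS](bigID P) /= lerDl; apply: sumr_ge0 => g _.
    by rewrite exprn_ge0 // ltW.
  rewrite sumr_const -mulr_natl ltr_pM2r ?exprn_gt0 //.
  by rewrite ltr_nat.
exists (fun f => M ^+ rank f / M ^+ #|E|.+1); split => [f||f].
- by rewrite divr_gt0 ?exprn_gt0.
- rewrite -mulr_suml ltr_pdivrMr ?exprn_gt0 // mul1r; apply: sum_lt => g _.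
  by rewrite ltnS max_card.
- rewrite -mulr_suml ltr_pM2r ?invr_gt0 ?exprn_gt0 //.
  by apply: sum_lt => g /andP[]; apply: rank_lt.
Qed.

(** The affine hull determines the direction space and so [d]. The coefficients follow by induction:
    at [t = i] the binomial is 1 for [k = i] and 0 for [i < k <= d]. *)
Lemma is_hstar_uniq (R : realType) (V : finType) (P : set {ffun V -> R^o})
    (h h' : {poly rat}) : is_hstar P h -> is_hstar P h' -> h = h'.
Proof.
move=> [d [[x [U [dU affU]]] szh eh]] [d' [[x' [U' [dU' affU']]] szh' eh']].
have transl (y : {ffun V -> R^o}) (W W' : {vspace {ffun V -> R^o}}) y' :
    [set y + u | u in [set u | u \in W]]%classic =
    [set y' + u | u in [set u | u \in W']]%classic -> (W <= W')%VS.
  move=> eqW; apply/subvP => u uW.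
  have : [set y + u | u in [set u | u \in W]]%classic (y + u) by exists u.
  have : [set y + u | u in [set u | u \in W]]%classic (y + 0).
    by exists 0 => //=; apply: mem0v.
  rewrite eqW => -[v /= vW' e1] [v' /= vW'' e2].
  suff -> : u = v' - v by rewrite memvB.
  apply: (addrI y); rewrite -e2 -[y in RHS]addr0 -e1.
  by rewrite addrACA subrr addr0.
have dd' : d = d'.
  rewrite -dU -dU'; congr (\dim _); apply: subv_anti.
  by rewrite (transl x U U' x') ?(transl x' U' U x) // -affU -affU'.
case: _ / dd' in szh' eh' *.
apply/polyP => i.
have [id|di] := leqP i d; last first.
  by rewrite !nth_default // (leq_trans _ di).
elim/ltn_ind: i id => i IH id.
have := eh i; rewrite eh'.
have dec (p : {poly rat}) : \sum_(k < d.+1) p`_k * ('C(i + d - k, d))%:R =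
   p`_i + \sum_(k < d.+1 | (k < i)%N) p`_k * ('C(i + d - k, d))%:R.
  rewrite (bigD1 (Ordinal (id : i < d.+1)%N)) //=.
  rewrite addnC addnK binn mulr1; congr (_ + _).
  rewrite (bigID (fun k : 'I__ => (k < i)%N)) /= addrC big1 ?add0r; last first.
    move=> k /andP[nk]; rewrite -leqNgt leq_eqVlt => /orP[/eqP ik|ik].
      by case/eqP: nk; apply: val_inj.
    have kd := ltn_ord k.
    by rewrite bin_small ?mulr0 //; lia.
  apply: eq_bigl => k; rewrite andbC; case: ltnP => //= ki.
  by apply/eqP => kE; rewrite kE ltnn in ki.
rewrite !dec => /eqP; rewrite (eq_bigr (fun k : 'I__ => h`_k * ('C(i + d - k, d))%:R)).
  by rewrite (inj_eq (addIr _)) => /eqP.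
by move=> k ki; rewrite IH //; lia.
Qed.

(** * Cycles, shores of tree edges, and the potential of a tree *)

Section Cycles.
Variable G : digraph.
Implicit Types (D T : {set edge G}) (e f : edge G) (d : dart G) (c : seq (dart G)).

Local Notation follows := (fun d d' : dart G => dart_target d == dart_source d').

Lemma adjacent_sym D : symmetric (adjacent D).
Proof. by move=> u v; apply: eq_existsb => e; rewrite orbC. Qed.

Lemma head_shore_tail T e f :
  f \in T -> f != e -> head_shore T e (tail f) = head_shore T e (head f).
Proof.
move=> fT nfe; apply: same_connect_r.
  exact/sym_connect_sym/adjacent_sym.
apply/connect1/existsP; exists f.
by rewrite !inE nfe fT !eqxx.
Qed.

(** The last clause allows any dart [d] ending at [u], so that the walk can be attached to a closing
    edge even when it is empty. *)
Lemma dart_path D u p : path (adjacent D) u p -> uniq (u :: p) ->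
  exists c, [/\ all (fun d => d.1 \in D) c, uniq (unzip1 c),
    map (@dart_source G) c = belast u p, map (@dart_target G) c = p
    & forall d, dart_target d = u ->
        path follows d c /\ dart_target (last d c) = last u p].
Proof.
elim: p u => [|v p IHp] u /=; first by move=> _ _; exists [::].
case/andP=> /existsP[e /andP[eD uv]] pth /andP[uN uniq_p].
have [c [cD uc src tgt ch]] := IHp v pth uniq_p.
have [b [sb tb]] : exists b, dart_source (e, b) = u /\ dart_target (e, b) = v.
  by case/orP: uv => /andP[/eqP <- /eqP <-]; [exists true | exists false].
exists ((e, b) :: c); split => /=.
- by rewrite eD.
- rewrite uc andbT; apply/mapP => -[[e' b'] dc /= ee'].
  (* A repeated edge would have [u] as an end, while both its ends lie on [v :: p]. *)
  case/negP: uN.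
  have sV : dart_source (e', b') \in v :: p.
    apply: mem_belast; rewrite -src; exact: map_f.
  have tV : dart_target (e', b') \in v :: p.
    by rewrite inE -[in X in _ || X]tgt map_f ?orbT.
  by move: sb sV tV => <-; rewrite -ee' /dart_source /dart_target; case: (b); case: (b').
- by rewrite sb src.
- by rewrite tb tgt.
- move=> d du; have [] := ch (e, b) tb.
  by rewrite du sb eqxx.
Qed.

Lemma cycle_of_connect D f :
    f \notin D -> connect (adjacent D) (head f) (tail f) ->
  exists c, graph_cycle ((f, true) :: c) /\ all (fun d => d.1 \in D) c.
Proof.
move=> fD /connectP[p0 pth0]; case/shortenP: pth0 => p pth uniq_p _ fp.
have [c [cD uc src tgt ch]] := dart_path pth uniq_p.
exists c; split=> //.
have [pc lc] := ch (f, true) erefl.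
apply/and4P; split=> //=.
- by rewrite rcons_path pc lc -fp eqxx.
- by rewrite -rcons_uniq src [dart_source _]fp -lastI.
- rewrite uc andbT; apply: contra fD => /mapP[d dc ->].
  exact: (allP cD).
Qed.

Lemma tail_notin_head_shore T e :
  spanning_tree T -> e \in T -> ~~ head_shore T e (tail e).
Proof.
move=> [_ acyc] eT; apply/negP => /cycle_of_connect.
rewrite !inE eqxx => /(_ isT)[c [cyc cT]].
have /negP := acyc _ cyc; apply => /=; rewrite eT /=.
by apply: sub_all cT => d; rewrite !inE => /andP[].
Qed.

Lemma path_telescope (M : zmodType) (phi : vertex G -> M) d c :
  path follows d c ->
  \sum_(d' <- c) (phi (dart_target d') - phi (dart_source d')) =
    phi (dart_target (last d c)) - phi (dart_target d).
Proof.
elim: c d => [|d' c IHc] d /=; first by rewrite big_nil subrr.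
case/andP=> /eqP dd' /IHc; rewrite big_cons dd' => ->.
by rewrite addrC addrA subrK.
Qed.

Lemma cycle_telescope (M : zmodType) (phi : vertex G -> M) c :
  path.cycle follows c ->
  \sum_(d <- c) (phi (dart_target d) - phi (dart_source d)) = 0.
Proof.
case: c => [|d c]; first by rewrite big_nil.
move=> /(path_telescope phi); rewrite last_rcons subrr -cats1 big_cat big_seq1.
by rewrite big_cons /= addrC => ->.
Qed.

(** The head shores, read as linear forms, are dual to the roots of [T]: deleting [e] separates the
    ends of [e] and of no other tree edge. *)
Lemma head_shore_dual (M : pzRingType) T e f :
  spanning_tree T -> e \in T -> f \in T ->
  (head_shore T e (head f))%:R - (head_shore T e (tail f))%:R = (e == f)%:R :> M.
Proof.
move=> treeT eT fT; have [<-|nef] := eqVneq e f.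
  rewrite (negPf (tail_notin_head_shore treeT eT)) subr0.
  by rewrite /head_shore connect0.
by rewrite head_shore_tail ?subrr // eq_sym.
Qed.

(** A height that rises by 1 along each edge of [T]. When [G] is semi-balanced it does so along
    every edge, which puts all roots on one hyperplane. *)
Definition potential (M : pzRingType) T (v : vertex G) : M :=
  \sum_(e in T) (head_shore T e v)%:R.

Lemma potential_tree_edge (M : pzRingType) T f :
  spanning_tree T -> f \in T ->
  potential M T (head f) - potential M T (tail f) = 1.
Proof.
move=> treeT fT; rewrite /potential -sumrB (bigD1 f) //=.
rewrite head_shore_dual // eqxx big1 ?addr0 // => e /andP[eT /negPf nef].
by rewrite head_shore_dual // nef.
Qed.

(** The increments of the potential cancel around the fundamental cycle of [f], where each tree edge
    contributes 1 or -1 according to its direction. *)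
Lemma potential_edge (M : pzRingType) T f :
  semi_balanced G -> spanning_tree T ->
  potential M T (head f) - potential M T (tail f) = 1.
Proof.
move=> balG treeT.
have [fT|fNT] := boolP (f \in T); first exact: potential_tree_edge.
have [c [cyc cT]] := cycle_of_connect fNT (treeT.1 _ _).
have bal := balG _ cyc.
have /and4P[_ cycc _ _] := cyc.
have := cycle_telescope (potential M T) cycc.
rewrite big_cons {1}/dart_target {1}/dart_source /=.
have -> : \sum_(d <- c) (potential M T (dart_target d) - potential M T (dart_source d))
    = (count (fun d => d.2) c)%:R - (count (fun d => ~~ d.2) c)%:R.
  elim: {cyc bal cycc} c cT => [|[e b] c IHc] /=; first by rewrite big_nil subrr.
  case/andP=> /= eT /IHc {}IHc.
  rewrite big_cons IHc !natrD opprD [RHS]addrACA; congr (_ + _).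
  case: b => /=; rewrite /dart_target /dart_source /= ?mulr0n ?mulr1n ?subr0.
    exact: potential_tree_edge.
  by rewrite sub0r -(potential_tree_edge M treeT eT) opprB.
(* Balance says that the tree part [c] has one more backward than forward dart, so its increments
   sum to -1. *)
move: bal; rewrite /= add0n => <-; rewrite natrD opprD [X in _ + X]addrCA subrr addr0.
by move/eqP; rewrite subr_eq0 => /eqP.
Qed.

End Cycles.

(** * Coordinates of zero-sum vectors in the roots of a tree *)

Section RootVectors.
Variables (R : realType) (G : digraph).
Local Notation RV := {ffun vertex G -> R^o}.
Implicit Types (T : {set edge G}) (e f : edge G) (x : RV) (c : vertex G -> R).

Definition dot c x : R^o := \sum_v c v * x v.

Lemma dot_is_linear c : linear (dot c).
Proof.
move=> a x y; rewrite /dot scaler_sumr -big_split /=; apply: eq_bigr => v _.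
by rewrite !ffunE mulrDr; congr (_ + _); rewrite /GRing.scale /= mulrCA.
Qed.
HB.instance Definition _ c :=
  GRing.isLinear.Build R RV R^o *:%R (dot c) (dot_is_linear c).

Lemma dot_std_basis c u : dot c (std_basis R u) = c u.
Proof.
rewrite /dot (bigD1 u) //= ffunE eqxx mulr1 big1 ?addr0 // => v /negPf nvu.
by rewrite ffunE nvu mulr0.
Qed.

Definition root_vector e : RV := std_basis R (head e) - std_basis R (tail e).

Lemma dot_root c e : dot c (root_vector e) = c (head e) - c (tail e).
Proof. by rewrite linearB /= !dot_std_basis. Qed.

Lemma dot_sum (I : Type) (r : seq I) (P : pred I) c (a : I -> R) (x : I -> RV) :
  dot c (\sum_(i <- r | P i) a i *: x i) = \sum_(i <- r | P i) a i * dot c (x i).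
Proof. by rewrite linear_sum; apply: eq_bigr => i _; rewrite linearZ. Qed.

Lemma dotD c x y : dot c (x + y) = dot c x + dot c y.
Proof. exact: linearD. Qed.

Lemma dotZ c (a : R) x : dot c (a *: x) = a * dot c x.
Proof. exact: linearZ. Qed.

Definition coord_sum x : R := dot (fun=> 1) x.

(* The coordinate of [x] along [root_vector e] in the basis of the roots of
   [T]; it is the linear form cutting out the facet of the simplex of [T]
   opposite to [e]. *)
Definition shore_sum T e x : R := dot (fun v => (head_shore T e v)%:R) x.

Lemma shore_sum_root T e f : spanning_tree T -> e \in T -> f \in T ->
  shore_sum T e (root_vector f) = (e == f)%:R.
Proof. by move=> treeT eT fT; rewrite /shore_sum dot_root head_shore_dual. Qed.

Lemma coord_sum_root e : coord_sum (root_vector e) = 0.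
Proof. by rewrite /coord_sum dot_root subrr. Qed.

(** Both sides are linear in [x] and agree on the roots of [T], hence, along paths in [T], on all
    differences of basis vectors, which span the zero-sum vectors. *)
Lemma tree_expansion T x : spanning_tree T -> coord_sum x = 0 ->
  x = \sum_(e in T) shore_sum T e x *: root_vector e.
Proof.
move=> treeT tx.
pose L (y : RV) : RV := \sum_(e in T) shore_sum T e y *: root_vector e.
have LD y z : L (y + z) = L y + L z.
  rewrite /L -big_split; apply: eq_bigr => e _.
  by rewrite /shore_sum dotD scalerDl.
have LZ a y : L (a *: y) = a *: L y.
  rewrite /L scaler_sumr; apply: eq_bigr => e _.
  by rewrite /shore_sum dotZ scalerA.
have L0 : L 0 = 0 by rewrite -[X in L X](scale0r (0 : RV)) LZ scale0r.
have Lroot f : f \in T -> L (root_vector f) = root_vector f.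
  move=> fT; rewrite /L (bigD1 f) //= shore_sum_root // eqxx scale1r.
  rewrite big1 ?addr0 // => e /andP[eT /negPf nef].
  by rewrite shore_sum_root // nef scale0r.
have LB u v : L (std_basis R v - std_basis R u) = std_basis R v - std_basis R u.
  have /connectP[p] := treeT.1 u v.
  elim: p u => [|w p IHp] u /= => [_ ->|/andP[/existsP[f /andP[fT uw]] pth] vl].
    by rewrite subrr L0.
  have -> : std_basis R v - std_basis R u =
      (std_basis R v - std_basis R w) + (std_basis R w - std_basis R u).
    by rewrite addrA subrK.
  rewrite LD IHp //; congr (_ + _).
  case/orP: uw => /andP[/eqP <- /eqP <-]; first exact: Lroot.
  by rewrite -opprB -scaleN1r LZ Lroot.
(* Extensionality supplies the base vertex [r]; as the entries of [x] sum to 0, [x] is a combination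
   of differences with the basis vector at [r]. *)
apply/ffunP => r.
have xE : x = \sum_v x v *: (std_basis R v - std_basis R r).
  under eq_bigr do rewrite scalerBr.
  rewrite sumrB -scaler_suml.
  have -> : \sum_v x v = 0 :> R.
    by rewrite -[RHS]tx; apply: eq_bigr => v _; rewrite mul1r.
  rewrite scale0r subr0; apply/ffunP => u; rewrite sum_ffunE (bigD1 u) //=.
  rewrite !ffunE eqxx /GRing.scale /= mulr1 big1 ?addr0 // => v /negPf nvu.
  by rewrite !ffunE eq_sym nvu /GRing.scale /= mulr0.
congr ((_ : RV) r); rewrite -/(L x) xE (big_morph L LD L0).
by apply: eq_bigr => v _; rewrite LZ LB.
Qed.

End RootVectors.

(** * The root polytope and the simplices of spanning trees *)

Section RootSimplices.
Variables (R : realType) (G : digraph).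
Local Notation RV := {ffun vertex G -> R^o}.
Implicit Types (D T : {set edge G}) (e f : edge G) (x y : RV).

(** A normal form with one coefficient per edge: choose an edge for each point, since parallel edges
    share a root, and add up the coefficients falling on the same edge. *)
Lemma root_polytopeP D x :
  root_polytope R D x <->
  exists b : edge G -> R, [/\ forall e, 0 <= b e, \sum_(e in D) b e = 1
    & x = \sum_(e in D) b e *: root_vector R e].
Proof.
split=> [[n [a [p [a0 a1 pD ->]]]]|[b [b0 b1 ->]]].
  have /choice[h hP] : forall i, exists e, e \in D /\ root_vector R e = p i.
    by move=> i; have [e eD <-] := pD i; exists e.
  have hD i : true -> h i \in D by move=> _; case: (hP i).
  exists (fun e => \sum_(i | h i == e) a i); split=> [e||].
  - exact: sumr_ge0.
  - by rewrite -a1 [RHS](partition_big h (fun e => e \in D)).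
  - rewrite (partition_big h (fun e => e \in D)) //=; apply: eq_bigr => e _.
    rewrite scaler_suml; apply: eq_bigr => i /eqP <-.
    by case: (hP i) => _ ->.
exists #|D|, (fun i => b (enum_val i)), (fun i => root_vector R (enum_val i)).
split=> // [|i|].
- by rewrite -b1 [RHS]big_enum_val.
- by exists (enum_val i) => //=; apply: enum_valP.
- by rewrite [LHS]big_enum_val.
Qed.

Lemma root_polytope_root D e : e \in D -> root_polytope R D (root_vector R e).
Proof.
move=> eD; exists 1%N, (fun=> 1), (fun=> root_vector R e).
by split=> // [|_|]; rewrite ?big_ord1 ?scale1r //; exists e.
Qed.

Definition level T x : R := dot (potential R T) x.

Lemma level_shore_sum T x : level T x = \sum_(e in T) shore_sum T e x.
Proof.
rewrite /level /shore_sum /dot exchange_big /=; apply: eq_bigr => v _.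
by rewrite /potential mulr_suml.
Qed.

Lemma shore_sum_int T e x :
  (forall v, x v \is a Num.int) -> shore_sum T e x \is a Num.int.
Proof.
move=> xint; apply: rpred_sum => v _.
by rewrite rpredM ?natr_int.
Qed.

Lemma coord_sum_roots (P : pred (edge G)) (b : edge G -> R) :
  coord_sum (\sum_(e | P e) b e *: root_vector R e) = 0.
Proof.
rewrite /coord_sum dot_sum big1 // => e _.
by rewrite [dot _ _]coord_sum_root mulr0.
Qed.

Lemma level_roots T (P : pred (edge G)) (b : edge G -> R) :
  semi_balanced G -> spanning_tree T ->
  level T (\sum_(e | P e) b e *: root_vector R e) = \sum_(e | P e) b e.
Proof.
move=> balG treeT; rewrite /level dot_sum; apply: eq_bigr => e _.
by rewrite dot_root potential_edge ?mulr1.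
Qed.

Lemma affine_hull_root_polytope T D x :
    semi_balanced G -> spanning_tree T ->
  affine_hull (root_polytope R D) x -> coord_sum x = 0 /\ level T x = 1.
Proof.
move=> balG treeT.
have PP y : root_polytope R D y -> coord_sum y = 0 /\ level T y = 1.
  move=> /root_polytopeP[b [_ b1 ->]].
  by rewrite coord_sum_roots level_roots.
move=> [n [a [p [a1 pP ->]]]]; rewrite /coord_sum /level !dot_sum; split.
  by rewrite big1 // => i _; rewrite [dot _ _](PP _ (pP i)).1 mulr0.
rewrite -[RHS]a1; apply: eq_bigr => i _.
by rewrite [dot _ _](PP _ (pP i)).2 mulr1.
Qed.

Lemma sub_affine_hull (S : set RV) x : S x -> affine_hull S x.
Proof.
move=> Sx; exists 1%N, (fun=> 1), (fun=> x); split=> //.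
  by rewrite big_ord1.
by rewrite big_ord1 scale1r.
Qed.

Lemma mem_root_simplex T x : spanning_tree T ->
  coord_sum x = 0 -> level T x = 1 -> (forall e, e \in T -> 0 <= shore_sum T e x) ->
  root_polytope R T x.
Proof.
move=> treeT x0 x1 xT; apply/root_polytopeP.
(* The maximum with 0 only acts outside [T], where coefficients must still be nonnegative. *)
exists (fun e => Num.max 0 (shore_sum T e x)); split=> [e||].
- by rewrite le_max lexx.
- rewrite -[RHS]x1 level_shore_sum; apply: eq_bigr => e /xT.
  by move/max_idPr.
- rewrite {1}(tree_expansion treeT x0); apply: eq_bigr => e /xT.
  by move/max_idPr ->.
Qed.

Lemma root_simplex_ge0 T x e : spanning_tree T -> e \in T ->
  root_polytope R T x -> 0 <= shore_sum T e x.
Proof.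
move=> treeT eT /root_polytopeP[b [b0 _ ->]].
rewrite /shore_sum dot_sum; apply: sumr_ge0 => f fT.
by rewrite mulr_ge0 // [dot _ _]shore_sum_root.
Qed.

Lemma root_simplex_interior T x : semi_balanced G -> spanning_tree T ->
  coord_sum x = 0 -> level T x = 1 -> (forall e, e \in T -> 0 < shore_sum T e x) ->
  relative_interior (root_polytope R T) x.
Proof.
move=> balG treeT x0 x1 xT; split.
  by apply: mem_root_simplex => // e /xT/ltW.
(* [m] is a positive lower bound for the coordinates of [x]. Moving every entry by less than [m / N]
   moves a shore sum by at most [m], since a shore has fewer than [N] vertices. *)
pose m : R := \big[Num.min/1]_(e in T) shore_sum T e x.
have m0 : 0 < m by apply: lt_bigmin.
pose N : R := #|vertex G|.+1%:R.
have N0 : 0 < N by rewrite ltr0n.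
exists (m / N); first by rewrite divr_gt0.
move=> y /(affine_hull_root_polytope balG treeT)[y0 y1] xy.
apply: mem_root_simplex => // e eT.
suff : `|shore_sum T e y - shore_sum T e x| <= m.
  have : m <= shore_sum T e x by apply: bigmin_le_cond.
  rewrite ler_norml => + /andP[]; lra.
rewrite /shore_sum /dot -sumrB; apply: (le_trans (ler_norm_sum _ _ _)).
apply: (@le_trans _ _ (\sum_(v : vertex G) m / N)).
  apply: ler_sum => v _; rewrite -mulrBr normrM.
  apply: (le_trans _ (ltW (xy v))).
  by apply: ler_piMl => //; rewrite ger0_norm ?ler0n // lern1 leq_b1.
rewrite sumr_const -mulr_natl mulrCA ler_piMr ?(ltW m0) //.
by rewrite ler_pdivrMr // mul1r ler_nat.
Qed.

End RootSimplices.

(** * The perturbation and its signs on fundamental cuts *)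

Section Perturbation.
Variables (R : realType) (G : digraph) (le : rel (edge G)).
Hypothesis leP : total_order le.
Local Notation RV := {ffun vertex G -> R^o}.
Implicit Types (T A : {set edge G}) (e f : edge G) (x y : RV).

Lemma total_order_max A e : e \in A ->
  exists2 f, f \in A & forall g, g \in A -> le g f.
Proof.
have [leR leA leT leTot] := leP => eA.
case: (@arg_maxnP _ e (mem A) (fun f => #|[set h | le h f]|) eA) => f fA fmax.
exists f => // g gA; have /orP[//|lfg] := leTot g f.
have sub : [set h | le h f] \subset [set h | le h g].
  by apply/fintype.subsetP => h; rewrite !inE => /leT; apply.
have /eqP/setP/(_ g) : [set h | le h f] == [set h | le h g].
  by rewrite eqEcard sub; apply: fmax.
by rewrite !inE leR.
Qed.

Variable w : edge G -> R.
Hypothesis w_gt0 : forall f, 0 < w f.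
Hypothesis w_sum : \sum_f w f < 1.
Hypothesis w_dom : forall f, \sum_(g | (g != f) && le g f) w g < w f.

Definition perturbation : RV := \sum_f w f *: root_vector R f.

Lemma shore_sum_perturbation T e :
  shore_sum T e perturbation =
  \sum_(f in fundamental_cut T e) (if head_shore T e (head f) then w f else - w f).
Proof.
rewrite /shore_sum dot_sum [RHS]big_mkcond; apply: eq_bigr => f _.
rewrite dot_root inE; case: (head_shore _ _ (tail f)); case: head_shore => //=.
- by rewrite subrr mulr0.
- by rewrite mulr0n mulr1n sub0r mulrN1.
- by rewrite mulr0n mulr1n subr0 mulr1.
- by rewrite subrr mulr0.
Qed.

Lemma shore_sum_perturbation_lt1 T e : `|shore_sum T e perturbation| < 1.
Proof.
apply: le_lt_trans w_sum; rewrite shore_sum_perturbation.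
apply: (le_trans (ler_norm_sum _ _ _)); rewrite [leRHS](bigID (mem (fundamental_cut T e))) /=.
rewrite -[leLHS]addr0 lerD //; last by apply: sumr_ge0 => f _; apply: ltW.
by apply: ler_sum => f _; case: ifP; rewrite ?normrN gtr0_norm.
Qed.

(** By [w_dom] the weight of the maximal cut edge exceeds the total weight of the others, so its
    direction decides the sign. *)
Lemma shore_sum_perturbation_max T e f :
  f \in fundamental_cut T e -> (forall g, g \in fundamental_cut T e -> le g f) ->
  (0 < shore_sum T e perturbation) = head_shore T e (head f) /\
  (shore_sum T e perturbation < 0) = ~~ head_shore T e (head f).
Proof.
move=> fC fmax; rewrite shore_sum_perturbation (bigD1 f) //=.
set s := \sum_(g in _ | _) _.
suff : `|s| < w f by rewrite ltr_norml => /andP[]; case: ifP => _; split; lra.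
apply: le_lt_trans (w_dom f).
apply: (le_trans (ler_norm_sum _ _ _)).
rewrite big_mkcond [leRHS]big_mkcond; apply: ler_sum => g _.
case: ifP => [/andP[gC ngf]|_].
  by rewrite ngf fmax //=; case: ifP; rewrite ?normrN gtr0_norm.
by case: ifP => // _; apply: ltW.
Qed.

Lemma mem_fundamental_cut T e :
  spanning_tree T -> e \in T -> e \in fundamental_cut T e.
Proof.
move=> treeT eT; rewrite inE (negPf (tail_notin_head_shore treeT eT)).
by rewrite /head_shore connect0.
Qed.

Lemma semi_passive_lt0 T e :
  internally_semi_passive le T e -> shore_sum T e perturbation < 0.
Proof.
case/andP=> _ /existsP[f /andP[fC /andP[/forall_inP fmax opp]]].
by rewrite (shore_sum_perturbation_max fC fmax).2.
Qed.

Lemma not_semi_passive_gt0 T e : spanning_tree T -> e \in T ->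
  ~~ internally_semi_passive le T e -> 0 < shore_sum T e perturbation.
Proof.
move=> treeT eT.
have [f fC fmax] := total_order_max (mem_fundamental_cut treeT eT).
rewrite (shore_sum_perturbation_max fC fmax).1; apply: contraNT => opp.
rewrite /internally_semi_passive eT; apply/existsP; exists f.
by rewrite fC /stands_opposite opp andbT; apply/forall_inP.
Qed.

End Perturbation.

(** * Lattice points of the dilations as points of half-open simplices *)

Section LatticePoints.
Variables (R : realType) (G : digraph) (TT : {set {set edge G}}).
Variables (le : rel (edge G)).
Hypothesis edgeG : (0 < #|edge G|)%N.
Hypothesis balG : semi_balanced G.
Hypothesis disTT : dissecting_tree_set R TT.
Hypothesis leP : total_order le.
Local Notation RV := {ffun vertex G -> R^o}.
Local Notation QG := (root_polytope R [set: edge G]).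
Implicit Types (T : {set edge G}) (e f : edge G) (x y : RV).

Definition passive_set T : {set edge G} :=
  [set e | internally_semi_passive le T e].

Lemma passive_subset T : passive_set T \subset T.
Proof. by apply/fintype.subsetP => e; rewrite inE => /andP[]. Qed.

Lemma root_polytope_nonempty : exists x, QG x.
Proof.
have [e _] : exists e : edge G, e \in edge G by apply/card_gt0P.
by exists (root_vector R e); apply: root_polytope_root; rewrite inE.
Qed.

Lemma dissecting_tree T : T \in TT -> spanning_tree T.
Proof. by case: disTT => + _ _; apply. Qed.

Lemma dissecting_nonempty : exists T, T \in TT.
Proof.
have [x] := root_polytope_nonempty; case: disTT => _ _ <- [T TTT _].
by exists T.
Qed.

Definition composition_point (t : nat)
    (Ta : {set edge G} * {ffun edge G -> 'I_t.+1}) : RV :=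
  \sum_(e in Ta.1) (Ta.2 e)%:R *: root_vector R e.

(** Tree coordinates of the lattice points of the dilated simplices, with the facets opposite to
    semi-passive edges removed. Keeping the tree in the pair turns the cardinality into a sum over
    [TT]. *)
Definition half_open_compositions (t : nat) :=
  [set Ta : {set edge G} * {ffun edge G -> 'I_t.+1} |
    (Ta.1 \in TT) && composition Ta.1 (passive_set Ta.1) Ta.2].

Lemma shore_sum_composition_point t T (a : {ffun edge G -> 'I_t.+1}) e :
    spanning_tree T -> e \in T ->
  shore_sum T e (composition_point (T, a)) = (a e)%:R.
Proof.
move=> treeT eT; rewrite /shore_sum dot_sum /= (bigD1 e) //=.
rewrite [dot _ _]shore_sum_root // eqxx mulr1 big1 ?addr0 // => f /andP[fT nfe].
by rewrite [dot _ _]shore_sum_root // eq_sym (negPf nfe) mulr0.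
Qed.

Variable w : edge G -> R.
Hypothesis w_gt0 : forall f, 0 < w f.
Hypothesis w_sum : \sum_f w f < 1.
Hypothesis w_dom : forall f, \sum_(g | (g != f) && le g f) w g < w f.
Local Notation q := (perturbation w).

Lemma w_sum_gt0 : 0 < \sum_f w f.
Proof.
have [e _] : exists e : edge G, e \in edge G by apply/card_gt0P.
rewrite (bigD1 e) //= ltr_pwDl // sumr_ge0 // => f _; exact: ltW.
Qed.

(** The coordinates of [q] in [T] add up to the total weight, which is positive, so they cannot all
    be negative. *)
Lemma card_passive_set T : spanning_tree T -> (#|passive_set T| < #|T|)%N.
Proof.
move=> treeT; rewrite ltn_neqAle subset_leq_card ?passive_subset // andbT.
apply/negP => /eqP eqc.
have /eqP eqT : passive_set T == T by rewrite eqEcard passive_subset eqc leqnn.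
have : 0 < level T q by rewrite level_roots // w_sum_gt0.
rewrite level_shore_sum ltNge => /negP; apply.
apply: sumr_le0 => e; move=> eT.
have pe : internally_semi_passive le T e by move: eT; rewrite -{1}eqT inE.
exact/ltW/(semi_passive_lt0 w_gt0 w_dom pe).
Qed.

Section Dilation.
Variable t : nat.

(** The level of [p + q] when [p] has level [t]; dividing by it returns to the hyperplane of the
    root polytope. It is positive even for [t = 0]. *)
Let lam : R := t%:R + \sum_f w f.

Lemma lam_gt0 : 0 < lam.
Proof. by rewrite ltr_wpDl ?w_sum_gt0. Qed.

(* A lattice point lies in the half-open cone of [T] iff its translate by the
   perturbation lies in the interior of the cone of [T]. *)
Lemma composition_point_interior Ta : Ta \in half_open_compositions t ->
  relative_interior (root_polytope R Ta.1) (lam^-1 *: (composition_point Ta + q)).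
Proof.
case: Ta => T a; rewrite inE /= => /andP[TTT /and3P[/forall_inP a0 /forall_inP posS /eqP suma]].
have treeT := dissecting_tree TTT.
apply: root_simplex_interior => //.
- rewrite /coord_sum dotZ dotD [X in X + _]coord_sum_roots [X in _ + X]coord_sum_roots.
  by rewrite addr0 mulr0.
- rewrite /level dotZ dotD [X in X + _]level_roots // [X in _ + X]level_roots //=.
  by rewrite -natr_sum suma mulVf // gt_eqF ?lam_gt0.
move=> e eT; rewrite /shore_sum dotZ dotD mulr_gt0 ?invr_gt0 ?lam_gt0 //.
rewrite [X in X + _]shore_sum_composition_point //.
have := shore_sum_perturbation_lt1 w_gt0 w_sum T e.
rewrite /shore_sum ltr_norml => /andP[lo _].
have [pe|npe] := boolP (internally_semi_passive le T e).
  have : 1 <= (a e)%:R :> R by rewrite ler1n posS // inE.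
  by move: lo; rewrite /shore_sum; lra.
have := not_semi_passive_gt0 leP w_gt0 w_dom treeT eT npe.
by rewrite /shore_sum => h; rewrite ltr_wpDl.
Qed.

(** A common point, translated by [q] and rescaled, would be interior to the simplices of both
    trees, so the trees agree; within one tree the shore sums recover the entries. *)
Lemma composition_point_inj :
  {in half_open_compositions t &, injective (@composition_point t)}.
Proof.
move=> [T a] [T' a'] Ta Ta' eqp.
have /= int := composition_point_interior Ta.
have /= int' := composition_point_interior Ta'.
move: (Ta) (Ta'); rewrite !inE /= => /andP[TTT /and3P[/forall_inP a0 _ _]].
move=> /andP[TTT' /and3P[/forall_inP a0' _ _]].
have eT : T = T'.
  apply: contrapT => /eqP nTT'; case: disTT => _ /(_ T T' TTT TTT' nTT') dis _.
  have : (relative_interior (root_polytope R T) `&`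
      relative_interior (root_polytope R T'))%classic
      (lam^-1 *: (composition_point (T, a) + q)).
    by split=> //; rewrite eqp.
  by rewrite dis.
case: _ / eT in eqp a0' *; congr (_, _); apply/ffunP => e.
have [eT|eNT] := boolP (e \in T); last first.
  by rewrite (eqP (a0 e _)) ?(eqP (a0' e _)) // inE.
apply: val_inj; apply/eqP; rewrite -(eqr_nat R) /=.
by rewrite -!(shore_sum_composition_point _ (dissecting_tree TTT)) // eqp.
Qed.

Lemma composition_point_lattice Ta : Ta \in half_open_compositions t ->
  dilated_lattice_points QG t (composition_point Ta).
Proof.
case: Ta => T a; rewrite inE /= => /andP[TTT /and3P[/forall_inP a0 _ /eqP suma]].
split; last first.
  move=> v; rewrite /composition_point sum_ffunE rpred_sum // => e eT.
  by rewrite !ffunE /GRing.scale /= rpredM ?natr_int // rpredB ?natr_int.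
(* For [t = 0] the point is 0 and cannot be divided by [t]; any point of the polytope serves as
   witness. *)
have [t0|t_gt0] := posnP t.
  have [p Qp] := root_polytope_nonempty; exists p => //.
  have -> : t%:R = 0 :> R by rewrite t0.
  rewrite scale0r /composition_point /= big1 // => e _.
  have ae : (a e <= t)%N by rewrite -ltnS.
  suff -> : a e = 0%N :> nat by rewrite scale0r.
  by apply/eqP; rewrite -leqn0; apply: leq_trans ae _; rewrite t0.
have tN0 : t%:R != 0 :> R by rewrite pnatr_eq0 -lt0n.
exists (t%:R^-1 *: composition_point (T, a)); last by rewrite scalerA divff // scale1r.
apply/root_polytopeP; exists (fun e => (a e)%:R / t%:R); split.
- by move=> e; rewrite divr_ge0.
- rewrite -mulr_suml -natr_sum (bigID (mem T)) /= (eq_bigl (mem T)); last first.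
    by move=> e; rewrite inE.
  rewrite suma big1 ?addn0 ?divff // => e /andP[_ eNT].
  by rewrite (eqP (a0 e _)) // inE.
- rewrite scaler_sumr big_mkcond [RHS]big_mkcond; apply: eq_bigr => e _ /=.
  rewrite inE scalerA mulrC; case: ifP => // /negbT eNT.
  by rewrite (eqP (a0 e _)) ?inE // mul0r scale0r.
Qed.

(** Adding [q] only increases the coefficients of the roots, so the rescaled [p + q] stays in the
    polytope and is covered by some simplex of [TT]. The coordinates of [p] in that tree give the
    composition. *)
Lemma composition_point_surj p : dilated_lattice_points QG t p ->
  exists2 Ta, Ta \in half_open_compositions t & composition_point Ta = p.
Proof.
move=> [[p0 Qp0 pE] pint].
have : QG (lam^-1 *: (p + q)).
  have /root_polytopeP[b [b0 b1 p0E]] := Qp0.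
  apply/root_polytopeP; exists (fun e => lam^-1 * (t%:R * b e + w e)); split.
  - move=> e; rewrite mulr_ge0 ?invr_ge0 ?(ltW lam_gt0) //.
    by rewrite addr_ge0 ?mulr_ge0 // ltW.
  - rewrite -mulr_sumr big_split /= -mulr_sumr b1 mulr1.
    rewrite [X in _ + X](eq_bigl predT) ?mulVf // => [|e]; last by rewrite inE.
    by rewrite gt_eqF ?lam_gt0.
  - under [RHS]eq_bigr do rewrite -scalerA.
    rewrite -scaler_sumr; congr (_ *: _).
    under [RHS]eq_bigr do rewrite scalerDl -scalerA.
    rewrite big_split /= -scaler_sumr -p0E -pE; congr (_ + _).
    by apply: eq_bigl => e; rewrite inE.
case: disTT => _ _ cover; rewrite -{1}cover => -[T /= TTT QT].
have treeT := dissecting_tree TTT.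
have [cp lp] : coord_sum p = 0 /\ level T p = t%:R.
  have [c0 l0] := affine_hull_root_polytope balG treeT (sub_affine_hull Qp0).
  rewrite pE /coord_sum /level !dotZ [X in _ * X = 0]c0 mulr0.
  by rewrite [X in _ * X]l0 mulr1.
have pT e : e \in T -> exists m : nat,
    shore_sum T e p = m%:R /\ (internally_semi_passive le T e -> (0 < m)%N).
  move=> eT; have /intrP[m mE] := shore_sum_int T e pint.
  have := root_simplex_ge0 treeT eT QT.
  rewrite /shore_sum dotZ pmulr_rge0 ?invr_gt0 ?lam_gt0 // dotD => ge0.
  have := shore_sum_perturbation_lt1 w_gt0 w_sum T e.
  rewrite ltr_norml => /andP[_ lt1].
  (* The integer [m] plus a number below 1 is nonnegative, so [m > -1]. *)
  have m_ge0 : 0 <= m.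
    rewrite -ltzD1 -(ltr_int R) intrD -mE.
    by move: ge0 lt1; rewrite /shore_sum; lra.
  case: m m_ge0 mE => // m _ mE; exists m; split=> // pe.
  have := semi_passive_lt0 w_gt0 w_dom pe.
  rewrite -(ltr_nat R); have := mE : shore_sum T e p = m%:R.
  by move: ge0; rewrite /shore_sum => + <-; lra.
have sump : \sum_(e in T) shore_sum T e p = t%:R by rewrite -level_shore_sum.
pose a : {ffun edge G -> 'I_t.+1} :=
  [ffun e => if e \in T then inord (Num.truncn (shore_sum T e p)) else ord0].
have aE e : e \in T -> (a e)%:R = shore_sum T e p.
  move=> eT; rewrite ffunE eT; have [m [mE _]] := pT e eT.
  rewrite mE natrK inordK // ltnS -(ler_nat R) -mE -sump (bigD1 e) //=.
  rewrite lerDl; apply: sumr_ge0 => f /andP[/pT[k [-> _]] _]; exact: ler0n.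
exists (T, a); last first.
  rewrite [RHS](tree_expansion treeT cp); apply: eq_bigr => e eT /=.
  by rewrite aE.
rewrite inE /= TTT /=; apply/and3P; split.
- by apply/forall_inP => e; rewrite inE ffunE => /negPf ->.
- apply/forall_inP => e; rewrite inE => pe; have eT := pe; case/andP: eT => eT _.
  have [m [mE m0]] := pT e eT.
  by rewrite -(ltr_nat R) aE // mE ltr_nat m0.
- rewrite -(eqr_nat R) natr_sum -sump; apply/eqP.
  by apply: eq_bigr => e; apply: aE.
Qed.

Lemma ehrhart_half_open : ehrhart QG t = #|half_open_compositions t|.
Proof.
rewrite /ehrhart.
(* Writing the set as the image of a finite set also keeps [fset_set] from its default value on
   infinite sets. *)
have -> : dilated_lattice_points QG t =
  [set` [fset composition_point Ta | Ta in half_open_compositions t]%fset]%classic.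
  apply/seteqP; split=> [p /composition_point_surj[Ta TaF <-]|p /=].
    by apply/imfsetP; exists Ta.
  by move=> /imfsetP[Ta /= TaF ->]; apply: composition_point_lattice.
rewrite set_fsetK card_in_imfset /=; last exact: composition_point_inj.
by rewrite cardE.
Qed.

End Dilation.
End LatticePoints.

(** * Number of edges of a spanning tree and dimension of the root polytope *)

Section Dimension.
Variables (R : realType) (G : digraph).
Local Notation RV := {ffun vertex G -> R^o}.
Implicit Types (T : {set edge G}).

Definition zero_sum_space : {vspace RV} := lker (linfun (dot (fun=> 1) : RV -> R^o)).

Lemma zero_sum_spaceE x : (x \in zero_sum_space) = (coord_sum x == 0).
Proof. by rewrite memv_ker lfunE. Qed.

(** The roots of [T] form a basis: they span by [tree_expansion] and are free by the dual forms.
    Hence all spanning trees have equally many edges. *)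
Lemma card_spanning_tree T : spanning_tree T -> #|T| = \dim zero_sum_space.
Proof.
move=> treeT; pose X := [tuple root_vector R (enum_val i) | i < #|T|].
have Xi (i : 'I_#|T|) : X`_i = root_vector R (enum_val i).
  by rewrite -tnth_nth tnth_mktuple.
suff /size_basis : basis_of zero_sum_space X by [].
apply/andP; split; last first.
  apply/freeP => k k0 i.
  have := congr1 (shore_sum T (enum_val i)) k0.
  rewrite /shore_sum dot_sum linear0 (bigD1 i) //= big1 => [|j nji].
    by rewrite Xi [dot _ _]shore_sum_root ?enum_valP // eqxx mulr1 addr0.
  rewrite Xi [dot _ _]shore_sum_root ?enum_valP // (inj_eq enum_val_inj).
  by rewrite eq_sym (negPf nji) mulr0.
rewrite eqEsubv; apply/andP; split.
  apply/span_subvP => x /mapP[i _ ->].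
  by rewrite zero_sum_spaceE coord_sum_root.
apply/subvP => x; rewrite zero_sum_spaceE => /eqP x0.
rewrite (tree_expansion treeT x0); apply: memv_suml => e eT.
apply/memvZ/memv_span/mapP; exists (enum_rank_in eT e); first by rewrite mem_enum.
by rewrite enum_rankK_in.
Qed.

Lemma root_polytope_dimension T d :
    (0 < #|edge G|)%N -> semi_balanced G -> spanning_tree T -> #|T| = d.+1 ->
  has_dimension (root_polytope R [set: edge G]) d.
Proof.
move=> /card_gt0P[e0 _] balG treeT cT.
pose l := linfun (dot (potential R T) : RV -> R^o).
exists (root_vector R e0), (zero_sum_space :&: lker l)%VS; split.
  have := limg_ker_dim l zero_sum_space.
  rewrite -(card_spanning_tree treeT) cT.
  (* The form [l] is scalar-valued and takes the value 1 on the root of [e0], so its kernel loses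
     exactly one dimension. *)
  suff -> : \dim (l @: zero_sum_space) = 1%N by rewrite addn1 => -[].
  apply/eqP; rewrite eqn_leq; apply/andP; split.
    by rewrite (leq_trans (dimvS (subvf _))) // dimvf.
  rewrite lt0n dimv_eq0; apply/negP => /eqP l0.
  have : l (root_vector R e0) \in (l @: zero_sum_space)%VS.
    by rewrite memv_img // zero_sum_spaceE coord_sum_root.
  rewrite l0 memv0 lfunE /= dot_root potential_edge //.
  by rewrite oner_eq0.
apply/seteqP; split=> [x /(affine_hull_root_polytope balG treeT)[x0 x1]|x].
  exists (x - root_vector R e0); last by rewrite addrC subrK.
  rewrite /= memv_cap zero_sum_spaceE memv_ker lfunE /=.
  apply/andP; split; apply/eqP; rewrite ?/coord_sum linearB /=.
    by rewrite [dot _ x]x0 [dot _ _]coord_sum_root subrr.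
  by rewrite [dot _ x]x1 dot_root potential_edge // subrr.
case=> u /=; rewrite memv_cap zero_sum_spaceE memv_ker lfunE /=.
move=> /andP[/eqP u0 /eqP u1] <-.
set y := _ + u.
have y0 : coord_sum y = 0.
  by rewrite /coord_sum dotD [X in X + _]coord_sum_root [X in _ + X]u0 addr0.
have y1 : level T y = 1.
  by rewrite /level dotD u1 addr0 dot_root potential_edge.
(* At level 1 the tree coordinates sum to 1, which makes the tree expansion an affine
   combination. *)
exists #|T|, (fun i => shore_sum T (enum_val i) y), (fun i => root_vector R (enum_val i)).
split=> [|i|].
- by rewrite -[RHS]y1 level_shore_sum [RHS]big_enum_val.
- by apply: root_polytope_root; rewrite inE.
- by rewrite {1}(tree_expansion treeT y0) [LHS]big_enum_val.
Qed.

End Dimension.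

(** * Assembly of the h*-polynomial from the counts over the trees *)

Theorem theorem1p9 (R : realType) (G : digraph)
    (TT : {set {set edge G}}) (le : rel (edge G))
    (edgeG : (0 < #|edge G|)%N)
    (balG : semi_balanced G)
    (disTT : dissecting_tree_set R TT)
    (leP : total_order le) (i : nat) :
  (hstar (root_polytope R [set: edge G]))`_i =
    #|[set T in TT | #|[set e | internally_semi_passive le T e]| == i]|%:R.
Proof.
have [w [w_gt0 w_sum w_dom]] := dominating_weights R leP.
have [T0 TT0] := dissecting_nonempty edgeG disTT.
have treeTT := dissecting_tree disTT.
pose k T := #|passive_set le T|.
(* The predecessor is harmless: [card_passive_set] shows that [T0] has an edge. *)
pose d := #|T0|.-1.
have cT T : T \in TT -> #|T| = d.+1.
  move=> TTT; rewrite /d (card_spanning_tree R (treeTT T TTT)).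
  rewrite -(card_spanning_tree R (treeTT T0 TT0)) prednK //.
  by apply: leq_trans (card_passive_set edgeG balG w_gt0 w_dom (treeTT _ TT0)).
have kd T : T \in TT -> (k T <= d)%N.
  move=> TTT; rewrite -ltnS -(cT T TTT).
  exact: (card_passive_set edgeG balG w_gt0 w_dom (treeTT _ TTT)).
pose H : {poly rat} := \poly_(j < d.+1) #|[set T in TT | k T == j]|%:R.
have HP : is_hstar (root_polytope R [set: edge G]) H.
  exists d; split.
  - exact: (root_polytope_dimension R edgeG balG (treeTT _ TT0) (cT _ TT0)).
  - exact: size_poly.
  move=> t; rewrite (ehrhart_half_open edgeG balG disTT leP w_gt0 w_sum w_dom).
  have -> : #|half_open_compositions TT le t| = (\sum_(T in TT) 'C(t + d - k T, d))%N.
    rewrite -sum1_card.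
    rewrite (eq_bigl (fun Ta => (Ta.1 \in TT) &&
        composition Ta.1 (passive_set le Ta.1) Ta.2)); last by move=> Ta; rewrite inE.
    rewrite -(pair_big_dep (fun T => T \in TT) (fun T a => composition T (passive_set le T) a)
      (fun _ _ => 1%N)) /=; apply: eq_bigr => T TTT.
    rewrite -(card_composition t (passive_subset le T) (cT T TTT) (kd T TTT)).
    by rewrite -sum1_card; apply: eq_bigl => a; rewrite inE.
  (* Trees are grouped by [k T]; [inord] is exact because [k T <= d]. *)
  rewrite natr_sum (partition_big (fun T => inord (k T) : 'I_d.+1) predT) //=.
  apply: eq_bigr => j _; rewrite coef_poly ltn_ord.
  have inTT T : (T \in TT) && (inord (k T) == j) = (T \in [set T in TT | k T == j]).
    rewrite inE; case: (boolP (T \in TT)) => //= TTT.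
    by rewrite -val_eqE /= inordK // ltnS kd.
  rewrite (eq_bigl _ _ inTT) mulr_natl -sumr_const; apply: eq_bigr => T.
  by rewrite inE => /andP[_ /eqP ->].
(* As [H] satisfies [is_hstar], [xget] returns a polynomial satisfying it too, and uniqueness
   identifies the two. *)
have -> : hstar (root_polytope R [set: edge G]) = H.
  exact: is_hstar_uniq (xgetPex 0 (ex_intro _ H HP)) HP.
(* Beyond degree [d] the coefficient is 0, and no tree has more than [d] semi-passive edges. *)
rewrite coef_poly; case: ltnP => // di.
suff -> : [set T in TT | #|[set e | internally_semi_passive le T e]| == i] = finset.set0.
  by rewrite cards0.
apply/setP => T; rewrite !inE; apply/negP => /andP[/kd kT /eqP kE].
by move: di; rewrite -kE ltnNge kT.
Qed.
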